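(* Assume $0\le\alpha=\alpha_n\le 1/\beta_n$ for all $n$. Let $g\in C_w^k[0,\infty)$ be twice continuously differentiable with $g',g''\in C_w^k[0,\infty)$. Then for every $x\ge0$, as $n\to\infty$, $$\beta_n\left|\mathcal{RL}_{n}^{[\alpha]}(g;x)-g(x)-g'(x)\,\mathcal{RL}_{n}^{[\alpha]}((t-x);x)-\frac{g''(x)}{2!}\,\mathcal{RL}_{n}^{[\alpha]}((t-x)^2;x)\right|=O(1)\,\Delta\left(g'';\sqrt{\frac{1}{\beta_n}}\right),$$ i.e. there is a constant $C$ independent of $n$ (it may depend on $x$) such that for all sufficiently large $n$ the left-hand side is at most $C\,\Delta(g'';\beta_n^{-1/2})$.
   Context: Standing data: $(\beta_n)_{n\in\mathbb N}$ is a strictly increasing sequence of real numbers with $\beta_1=1$ and $\beta_n\to\infty$; $\phi,\psi$ are fixed reals with $0\le\phi\le\psi$; $\alpha=\alpha_n\ge 0$ is a sequence of nonnegative reals (the index $n$ is suppressed). For $i\ge1$ put $x^{(i,-\alpha)}=\prod_{j=1}^{i}(x+(j-1)\alpha)$, and $x^{(0,-\alpha)}=1$. For $x\ge0$ and locally integrable $g$ on $[0,\infty)$ for which the series converges absolutely (in particular for $g$ of at most polynomial growth) define $$\mathcal{RL}_{n}^{[\alpha]}(g;x)=\beta_n\sum_{i=0}^{\infty}(1+\beta_n\alpha)^{-x/\alpha}\left(\alpha+\frac{1}{\beta_n}\right)^{-i}\frac{x^{(i,-\alpha)}}{i!}\int_{i/\beta_n}^{(i+1)/\beta_n}g\left(\frac{\beta_n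 t+\phi}{\beta_n+\psi}\right)dt,$$ where for $\alpha=0$ the factor $(1+\beta_n\alpha)^{-x/\alpha}$ is read as its limit $e^{-\beta_n x}$. In $\mathcal{RL}_{n}^{[\alpha]}((t-x)^m;x)$ the operator acts on the function of the variable $t$. Let $w(x)=1+x^2$. $C_w^k[0,\infty)$ is the set of continuous $g:[0,\infty)\to\mathbb{R}$ with $|g(x)|\le Mw(x)$ for some constant $M>0$ and such that $\lim_{x\to\infty}|g(x)|/w(x)=k_g$ exists and is finite ($k$ is only a label). The weighted modulus of continuity of $g\in C_w^k[0,\infty)$ is, for $\delta>0$, $$\Delta(g;\delta)=\sup_{0\le h\le\delta,\ x\ge0}\frac{|g(x+h)-g(x)|}{(1+h^2)(1+x^2)}.$$ *)

(* Defs.v *)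
From Stdlib Require Export Reals Factorial.
From Coquelicot Require Export Coquelicot.

Open Scope R_scope.

(* Functions on [0, oo) are represented by total functions R -> R; every notion
   below only looks at their values on [0, oo). *)
Definition half_line (x : R) : Prop := 0 <= x.

(* x^{(i, -a)} = x (x + a) ... (x + (i - 1) a) *)
Fixpoint rising (x a : R) (i : nat) : R :=
  match i with
  | O => 1
  | S j => rising x a j * (x + INR j * a)
  end.

(* (1 + b a)^(- x / a), and its limit exp (- b x) as a -> 0 when a = 0 *)
Definition RL_factor (b a x : R) : R :=
  if Req_EM_T a 0 then exp (- (b * x)) else Rpower (1 + b * a) (- x / a).

(* The operator RL_n^{[alpha]}(g; x), with b = beta_n and a = alpha_n.
   [Series] and [RInt] are total: they carry the intended meaning when the
   integrals exist and the series converges, in particular when g is continuous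
   and of polynomial growth on [0, oo). *)
Definition RL (phi psi b a : R) (g : R -> R) (x : R) : R :=
  b * Series (fun i : nat =>
    RL_factor b a x * / (a + 1 / b) ^ i * (rising x a i / INR (fact i)) *
    RInt (fun t => g ((b * t + phi) / (b + psi))) (INR i / b) (INR (S i) / b)).

Definition weight (x : R) : R := 1 + x ^ 2.

Definition C_w_k (g : R -> R) : Prop :=
  continuous_on half_line g /\
  (exists M : R, 0 < M /\ forall x, 0 <= x -> Rabs (g x) <= M * weight x) /\
  (exists k : R, is_lim (fun x => Rabs (g x) / weight x) p_infty k).

(* Weighted modulus of continuity. The supremum is taken in Rbar; for g in
   C_w_k it is finite, since weight (x + h) <= 2 (1 + h^2) (1 + x^2), so that the
   projection [real] loses nothing. *)
Definition weighted_modulus (g : R -> R) (delta : R) : R :=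
  real (Lub_Rbar (fun r => exists h x : R,
    0 <= h <= delta /\ 0 <= x /\
    r = Rabs (g (x + h) - g x) / ((1 + h ^ 2) * (1 + x ^ 2)))).

(* Main.v *)
Require Import Defs.
From Stdlib Require Import Lra Lia Psatz.
Open Scope R_scope.

(** The weights of the operator are a negative binomial law (Poisson when
    [alpha = 0]); let [Y = i / beta - x] under that law, with [e = 1 / beta].
    Its generating function gives total mass 1, and the recurrence between
    consecutive weights gives all central moments: [E Y = 0], [E Y^2 = O(e)],
    [E Y^6 = O(e^3)]. By two applications of the mean value theorem, the Taylor
    remainder at [t] is at most [(t - x)^2] times an increment of [g''], which
    splits into steps of length [d = sqrt e]; this bounds it by a constant times
    [Delta (g''; d) ((t - x)^2 + (t - x)^6 / d^4)]. Since the nodes seen by the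
    operator are within [O(|Y| + e)] of [x], taking means yields [O(e)]. *)

(** * The coefficients of the weights and their generating function *)

Definition rising_coef (x a : R) (i : nat) : R := rising x a i / INR (fact i).

Lemma rising_coef_S (x a : R) (i : nat) :
  INR (S i) * rising_coef x a (S i) = rising_coef x a i * (x + INR i * a).
Proof.
  unfold rising_coef. rewrite fact_simpl, mult_INR. simpl rising.
  assert (INR (S i) <> 0) by (apply not_0_INR; lia).
  assert (INR (fact i) <> 0) by apply INR_fact_neq_0.
  field. auto.
Qed.

Lemma rising_coef_pos (x a : R) (i : nat) :
  0 <= x -> 0 <= a -> 0 <= rising_coef x a i.
Proof.
  intros Hx Ha. unfold rising_coef. apply Rcomplements.Rdiv_le_0_compat.
  - induction i as [|i IH]; simpl; [lra|].
    apply Rmult_le_pos; [exact IH|].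
    assert (0 <= INR i * a) by (apply Rmult_le_pos; [apply pos_INR|lra]). lra.
  - apply INR_fact_lt_0.
Qed.

Lemma eventually_decr_bounded (u : nat -> R) (N : nat) :
  (forall i, 0 <= u i) -> (forall i, (N <= i)%nat -> u (S i) <= u i) ->
  exists M, forall i, u i <= M.
Proof.
  intros Hpos Hdec.
  exists (sum_n u N).
  assert (Hle : forall n i, (i <= n)%nat -> u i <= sum_n u n).
  { induction n as [|n IH]; intros i Hi.
    - replace i with 0%nat by lia. rewrite sum_O. lra.
    - rewrite sum_Sn. unfold plus; simpl.
      assert (Hs : 0 <= sum_n u n) by (apply Rle_trans with (u 0%nat); [auto|apply IH; lia]).
      destruct (Nat.eq_dec i (S n)) as [->|Hne]; [lra|].
      specialize (IH i ltac:(lia)). specialize (Hpos (S n)). lra. }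
  assert (Htail : forall k, u (N + k)%nat <= u N).
  { induction k as [|k IH]; [rewrite Nat.add_0_r; lra|].
    rewrite Nat.add_succ_r. apply Rle_trans with (2 := IH). apply Hdec; lia. }
  intros i. destruct (Nat.le_gt_cases i N) as [Hi|Hi]; [auto|].
  replace i with (N + (i - N))%nat by lia.
  apply Rle_trans with (1 := Htail _). apply Hle; lia.
Qed.

(** The ratio of consecutive terms [rising_coef x a i * r ^ i] is [(x + i * a) * r / (i + 1)], with
    limit [a * r < 1]; so the terms are eventually nonincreasing, hence bounded. *)
Lemma rising_coef_CV_radius (x a r : R) :
  0 <= x -> 0 <= a -> 0 <= r -> a * r < 1 ->
  Rbar_le r (CV_radius (rising_coef x a)).
Proof.
  intros Hx Ha Hr Har.
  apply (proj1 (CV_radius_bounded (rising_coef x a))).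
  assert (Hpos : forall i, 0 <= rising_coef x a i * r ^ i).
  { intros i. apply Rmult_le_pos; [now apply rising_coef_pos|now apply pow_le]. }
  destruct (nfloor_ex (x * r / (1 - a * r))) as [N HN].
  { apply Rcomplements.Rdiv_le_0_compat; [apply Rmult_le_pos; lra|lra]. }
  destruct (eventually_decr_bounded (fun i => rising_coef x a i * r ^ i) (S N) Hpos)
    as [M HM].
  { intros i Hi.
    assert (HSi : 0 < INR (S i)) by (apply lt_0_INR; lia).
    apply Rmult_le_reg_l with (1 := HSi).
    rewrite <- Rmult_assoc, rising_coef_S, <- tech_pow_Rmult.
    replace (rising_coef x a i * (x + INR i * a) * (r * r ^ i))
      with ((x * r + INR i * (a * r)) * (rising_coef x a i * r ^ i)) by ring.
    apply Rmult_le_compat_r; [apply Hpos|].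
    rewrite S_INR.
    assert (HNi : INR N + 1 <= INR i) by (rewrite <- S_INR; now apply le_INR).
    assert (Hlt : x * r / (1 - a * r) < INR i) by lra.
    apply Rcomplements.Rlt_div_l in Hlt; lra. }
  exists M. intros i. rewrite Rabs_pos_eq by apply Hpos. apply HM.
Qed.

Lemma rising_coef_CV_radius_lt (x a z : R) :
  0 <= x -> 0 <= a -> 0 <= z -> a * z < 1 ->
  Rbar_lt (Rabs z) (CV_radius (rising_coef x a)).
Proof.
  intros Hx Ha Hz Haz. rewrite Rabs_pos_eq by lra.
  (* Any [r > z] with [a * r < 1] would serve; this one has [1 - a * r = (1 - a * z) / (1 + a)] and
     also covers [a = 0]. *)
  set (r := z + (1 - a * z) / (1 + a)).
  assert (Hd : 0 < (1 - a * z) / (1 + a)) by (apply Rdiv_lt_0_compat; lra).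
  assert (Hr : z < r) by (unfold r; lra).
  assert (Hzr : Rbar_lt z r) by exact Hr.
  eapply Rbar_lt_le_trans; [exact Hzr|]. apply rising_coef_CV_radius; try lra.
  unfold r.
  replace (a * (z + (1 - a * z) / (1 + a))) with (1 - (1 - a * z) / (1 + a)) by (field; lra).
  lra.
Qed.

(** This is the operator [t * d/dt] on power series. Neither differentiation nor the shift changes
    the radius of convergence, so powers of the index can be inserted freely. *)
Lemma mult_INR_PS (c : nat -> R) (i : nat) :
  INR i * c i = PS_incr_1 (PS_derive c) i.
Proof.
  destruct i as [|i]; unfold PS_derive; simpl PS_incr_1; [|reflexivity].
  simpl INR. rewrite Rmult_0_l. reflexivity.
Qed.

Lemma CV_radius_mult_pow_INR (c : nat -> R) (m : nat) :
  CV_radius (fun i => INR i ^ m * c i) = CV_radius c.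
Proof.
  induction m as [|m IH].
  - apply CV_radius_ext. intros i. simpl. ring.
  - rewrite <- IH, <- (CV_radius_derive (fun i => INR i ^ m * c i)).
    rewrite <- (CV_radius_incr_1 (PS_derive _)). apply CV_radius_ext. intros i. rewrite <- mult_INR_PS. simpl. ring.
Qed.

(* The generating function [F] of the coefficients solves [(1 - a t) F' = x F]. *)
Lemma PSeries_rising_coef (x a z : R) (Phi : R -> R) :
  0 <= x -> 0 <= a -> 0 < z -> a * z < 1 ->
  (forall t, 0 <= t <= z -> is_derive Phi t (x / (1 - a * t))) ->
  PSeries (rising_coef x a) z = exp (Phi z - Phi 0).
Proof.
  intros Hx Ha Hz Haz HPhi.
  set (c := rising_coef x a).
  assert (Hat : forall t, 0 <= t <= z -> a * t < 1).
  { intros t Ht. apply Rle_lt_trans with (2 := Haz). apply Rmult_le_compat_l; lra. }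
  assert (Hode : forall t, 0 <= t <= z ->
            PSeries (PS_derive c) t = x / (1 - a * t) * PSeries c t).
  { intros t Ht. specialize (Hat t Ht).
    assert (Hrad : Rbar_lt (Rabs t) (CV_radius c)) by (apply rising_coef_CV_radius_lt; lra).
    (* The coefficient recurrence, read as the identity [F' = x F + a t F'] of power series. *)
    assert (Heq : PSeries (PS_derive c) t
                  = x * PSeries c t + a * (t * PSeries (PS_derive c) t)).
    { rewrite <- PSeries_incr_1, <- (PSeries_scal x), <- (PSeries_scal a), <- PSeries_plus.
      - apply PSeries_ext. intros i.
        unfold PS_plus, PS_scal, plus, scal; simpl; unfold mult; simpl.
        rewrite <- mult_INR_PS. unfold PS_derive, c. rewrite rising_coef_S. ring.
      - apply ex_pseries_scal; [apply Rmult_comm|]. now apply CV_radius_inside.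
      - apply ex_pseries_scal; [apply Rmult_comm|]. apply CV_radius_inside.
        rewrite CV_radius_incr_1, CV_radius_derive. exact Hrad. }
    apply Rmult_eq_reg_l with (1 - a * t); [|lra].
    transitivity (x * PSeries c t); [lra|field; lra]. }
  (* By the differential equation, [F * exp (- Phi)] has derivative zero. An arbitrary primitive
     [Phi] treats [a = 0] and [a > 0] together. *)
  assert (Hconst : PSeries c 0 * exp (- Phi 0) = PSeries c z * exp (- Phi z)).
  { apply (eq_is_derive (V := R_NormedModule) (fun t => PSeries c t * exp (- Phi t))); [|exact Hz].
    intros t Ht.
    assert (HF : is_derive (PSeries c) t (x / (1 - a * t) * PSeries c t)).
    { rewrite <- Hode by exact Ht. apply is_derive_PSeries.
      apply rising_coef_CV_radius_lt; try lra. auto. }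
    specialize (HPhi t Ht). revert HF HPhi. generalize (PSeries c). intros F HF HPhi.
    auto_derive.
    - repeat split; eexists; eassumption.
    - replace (Derive _ t) with (x / (1 - a * t) * F t) by (symmetry; now apply is_derive_unique).
      replace (Derive _ t) with (x / (1 - a * t)) by (symmetry; now apply is_derive_unique).
      unfold zero; simpl. ring. }
  rewrite PSeries_0 in Hconst. unfold c in Hconst at 1. unfold rising_coef in Hconst. simpl in Hconst.
  unfold Rminus. rewrite exp_plus.
  replace (exp (Phi z)) with (/ exp (- Phi z)) by (rewrite exp_Ropp, Rinv_inv; reflexivity).
  apply Rmult_eq_reg_r with (exp (- Phi z)); [|apply Rgt_not_eq, exp_pos].
  rewrite <- Hconst. field. apply Rgt_not_eq, exp_pos.
Qed.

(** * The weights, their total mass and their central moments *)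

Definition RL_weight (b a x : R) (i : nat) : R :=
  RL_factor b a x * / (a + 1 / b) ^ i * (rising x a i / INR (fact i)).

Lemma RL_weight_rising_coef (b a x : R) (i : nat) :
  RL_weight b a x i = RL_factor b a x * (rising_coef x a i * (/ (a + 1 / b)) ^ i).
Proof. unfold RL_weight, rising_coef. rewrite pow_inv. ring. Qed.

Lemma Rmult_le_bounds (u s U : R) : 0 <= u <= U -> 0 <= s -> 0 <= u * s <= U * s.
Proof.
  intros [Hu HU] Hs. split; [now apply Rmult_le_pos|now apply Rmult_le_compat_r].
Qed.

(** The equations are the moment recurrence with [m_0 = 1] and [m_1 = 0] inserted, for
    [e = 1 / beta] and [c = alpha * beta]. After powers of [e] are factored out, only polynomials
    with nonnegative coefficients remain, bounded through [c <= 1] and [e <= 1]. *)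
Lemma sixth_moment_bound (x e c m2 m3 m4 m5 m6 : R) :
  0 <= x -> 0 <= c <= 1 -> 0 < e <= 1 ->
  m2 = (1 + c) * x * e ->
  m3 = (1 + c) * x * e ^ 2 + 2 * c * e * m2 ->
  m4 = (1 + c) * x * (3 * e * m2 + e ^ 3) + c * (3 * e * m3 + 3 * e ^ 2 * m2) ->
  m5 = (1 + c) * x * (4 * e * m3 + 6 * e ^ 2 * m2 + e ^ 4)
       + c * (4 * e * m4 + 6 * e ^ 2 * m3 + 4 * e ^ 3 * m2) ->
  m6 = (1 + c) * x * (5 * e * m4 + 10 * e ^ 2 * m3 + 10 * e ^ 3 * m2 + e ^ 5)
       + c * (5 * e * m5 + 10 * e ^ 2 * m4 + 10 * e ^ 3 * m3 + 5 * e ^ 4 * m2) ->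
  m6 <= 2400 * (1 + x) ^ 3 * e ^ 3.
Proof.
  intros Hx Hc He E2 E3 E4 E5 E6.
  set (T := 1 + x). set (A := (1 + c) * x).
  assert (HA : 0 <= A <= 2 * T).
  { assert (H := Rmult_le_bounds (1 + c) x 2 ltac:(lra) Hx). unfold A, T. lra. }
  assert (HT : 1 <= T) by (unfold T; lra).
  assert (HT2 : T <= T ^ 2) by nra.
  assert (HT3 : T ^ 2 <= T ^ 3) by nra.
  assert (Hee : forall s, 0 <= s -> 0 <= e * s <= s).
  { intros s Hs. assert (H := Rmult_le_bounds e s 1 ltac:(lra) Hs). lra. }
  assert (Hcc : forall s, 0 <= s -> 0 <= c * s <= s).
  { intros s Hs. assert (H := Rmult_le_bounds c s 1 Hc Hs). lra. }
  (* [n_k] is [m_k] divided by [e ^ ceil (k / 2)] *)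
  set (n3 := A + 2 * (c * A)).
  set (n4 := A * (3 * A + e) + c * (3 * (e * n3) + 3 * (e * A))).
  set (n5 := A * (4 * n3 + 6 * A + e) + c * (4 * n4 + 6 * (e * n3) + 4 * (e * A))).
  set (n6 := A * (5 * n4 + 10 * (e * n3) + 10 * (e * A) + e * e)
    + c * (5 * (e * n5) + 10 * (e * n4) + 10 * (e * (e * n3)) + 5 * (e * (e * A)))).
  (* Each constant comes from inserting the previous bounds and [A <= 2 * T], then raising lower
     powers of [T >= 1] to the highest one; 2400 is rounded up from 2342. *)
  assert (H3 : 0 <= n3 <= 6 * T).
  { assert (H := Hcc A ltac:(lra)). unfold n3. lra. }
  assert (HeA := Hee A ltac:(lra)). assert (He3 := Hee n3 ltac:(lra)).
  assert (HeeA := Hee (e * A) ltac:(lra)). assert (Hee3 := Hee (e * n3) ltac:(lra)).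
  assert (H4 : 0 <= n4 <= 38 * T ^ 2).
  { assert (H := Rmult_le_bounds A (3 * A + e) (2 * T) HA ltac:(lra)).
    assert (H' := Hcc (3 * (e * n3) + 3 * (e * A)) ltac:(lra)).
    assert (2 * T * (3 * A + e) <= 2 * T * (6 * T + 1)) by (apply Rmult_le_compat_l; lra).
    unfold n4. lra. }
  assert (He4 := Hee n4 ltac:(lra)).
  assert (H5 : 0 <= n5 <= 270 * T ^ 2).
  { assert (H := Rmult_le_bounds A (4 * n3 + 6 * A + e) (2 * T) HA ltac:(lra)).
    assert (H' := Hcc (4 * n4 + 6 * (e * n3) + 4 * (e * A)) ltac:(lra)).
    assert (2 * T * (4 * n3 + 6 * A + e) <= 2 * T * (36 * T + 1))
      by (apply Rmult_le_compat_l; lra).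
    unfold n5. lra. }
  assert (He5 := Hee n5 ltac:(lra)). assert (Hee1 := Hee e ltac:(lra)).
  assert (H6 : n6 <= 2400 * T ^ 3).
  { assert (H := Rmult_le_bounds A
      (5 * n4 + 10 * (e * n3) + 10 * (e * A) + e * e) (2 * T) HA ltac:(lra)).
    assert (H' := Hcc (5 * (e * n5) + 10 * (e * n4) + 10 * (e * (e * n3))
                       + 5 * (e * (e * A))) ltac:(lra)).
    assert (2 * T * (5 * n4 + 10 * (e * n3) + 10 * (e * A) + e * e)
            <= 2 * T * (190 * T ^ 2 + 80 * T + 1)) by (apply Rmult_le_compat_l; lra).
    unfold n6. lra. }
  replace m6 with (n6 * e ^ 3).
  - apply Rmult_le_compat_r; [apply pow_le; lra|exact H6].
  - rewrite E6, E5, E4, E3, E2. unfold n6, n5, n4, n3, A. ring.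
Qed.

Definition RL_moment (b a x : R) (m : nat) : R :=
  Series (fun i => RL_weight b a x i * (INR i / b - x) ^ m).

Section Weights.

Context (b a x : R) (Hb : 1 <= b) (Ha : 0 <= a <= 1 / b) (Hx : 0 <= x).

Notation p := (RL_weight b a x).
Notation z := (/ (a + 1 / b)).

Let b_pos : 0 < b. Proof. lra. Qed.

Let inv_b_pos : 0 < 1 / b. Proof. apply Rdiv_lt_0_compat; lra. Qed.

Let z_pos : 0 < z. Proof. apply Rinv_0_lt_compat. lra. Qed.

Let az_lt_1 : a * z < 1.
Proof. apply (Rcomplements.Rdiv_lt_1 a (a + 1 / b)); lra. Qed.

Lemma RL_factor_pos : 0 < RL_factor b a x.
Proof. unfold RL_factor. destruct Req_EM_T; apply exp_pos. Qed.

Lemma RL_weight_pos (i : nat) : 0 <= p i.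
Proof.
  rewrite RL_weight_rising_coef. apply Rmult_le_pos; [apply Rlt_le, RL_factor_pos|].
  apply Rmult_le_pos; [apply rising_coef_pos; lra|apply pow_le; lra].
Qed.

(** The recurrence of the coefficients, combined with [z = b / (1 + a * b)]. All moment computations
    rest on it. *)
Lemma RL_weight_S (i : nat) :
  (1 + a * b) * (INR (S i) / b) * p (S i) = p i * (x + INR i * a).
Proof.
  rewrite !RL_weight_rising_coef.
  replace ((1 + a * b) * (INR (S i) / b)
            * (RL_factor b a x * (rising_coef x a (S i) * z ^ S i)))
    with (RL_factor b a x * (INR (S i) * rising_coef x a (S i)) * ((1 + a * b) / b * z) * z ^ i)
    by (simpl pow; unfold Rdiv; ring).
  rewrite rising_coef_S.
  replace ((1 + a * b) / b * z) with 1; [ring|].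
  field. split; [lra|]. assert (0 <= a * b) by (apply Rmult_le_pos; lra). lra.
Qed.

Lemma ex_series_RL_weight_pow (m : nat) : ex_series (fun i => p i * INR i ^ m).
Proof.
  apply ex_series_ext with
    (fun i => scal (RL_factor b a x) (INR i ^ m * rising_coef x a i * z ^ i)).
  { intros i. rewrite RL_weight_rising_coef. unfold scal; simpl; unfold mult; simpl. ring. }
  apply (ex_series_scal (V := R_NormedModule)).
  apply ex_pseries_R, CV_radius_inside. rewrite CV_radius_mult_pow_INR.
  apply rising_coef_CV_radius_lt; lra.
Qed.

(** The primitive of [x / (1 - a * t)] is [x * t] for [a = 0] and a multiple of [ln (1 - a * t)]
    otherwise. As [1 - a * z = / (1 + b * a)], the generating function at [z] is the inverse of
    [RL_factor]. *)
Lemma Series_RL_weight : Series p = 1.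
Proof.
  rewrite (Series_ext _ (fun i => RL_factor b a x * (rising_coef x a i * z ^ i)))
    by apply RL_weight_rising_coef.
  rewrite Series_scal_l. fold (PSeries (rising_coef x a) z).
  unfold RL_factor. destruct Req_EM_T as [Ha0|Ha0].
  - rewrite (PSeries_rising_coef x a z (fun t => x * t)); try lra.
    + rewrite <- exp_plus. transitivity (exp 0); [f_equal|apply exp_0].
      rewrite Ha0. field. lra.
    + intros t Ht. rewrite Ha0. replace (x / (1 - 0 * t)) with x by field.
      auto_derive; [trivial|ring].
  - assert (Hab : 0 <= a * b) by (apply Rmult_le_pos; lra).
    rewrite (PSeries_rising_coef x a z (fun t => - x / a * ln (1 - a * t))); try lra.
    + unfold Rpower. rewrite <- exp_plus. transitivity (exp 0); [f_equal|apply exp_0].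
      rewrite Rmult_0_r, Rminus_0_r, ln_1.
      replace (1 - a * z) with (/ (1 + b * a)) by (field; split; lra).
      rewrite ln_Rinv by lra. field. exact Ha0.
    + intros t Ht.
      assert (a * t < 1) by (apply Rle_lt_trans with (2 := az_lt_1), Rmult_le_compat_l; lra).
      auto_derive; [lra|]. field. split; [lra|exact Ha0].
Qed.

Notation Y := (fun i => INR i / b - x).
Notation e := (1 / b).
Notation mu := (RL_moment b a x).

(** The exponent [k] stays general because each factor [Y] splits into [INR i / b] and [- x], and
    the first piece raises [k] by one in the induction. *)
Lemma ex_series_RL_weight_central (m k : nat) :
  ex_series (fun i => p i * INR i ^ k * Y i ^ m).
Proof.
  revert k. induction m as [|m IH]; intros k.
  - apply ex_series_ext with (2 := ex_series_RL_weight_pow k). intros i. simpl. ring.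
  - apply ex_series_ext with
      (fun i => minus (scal e (p i * INR i ^ S k * Y i ^ m)) (scal x (p i * INR i ^ k * Y i ^ m))).
    { intros i. unfold minus, plus, opp, scal; simpl; unfold mult; simpl. field. lra. }
    apply (ex_series_minus (V := R_NormedModule));
      apply (ex_series_scal (V := R_NormedModule)); apply IH.
Qed.

Lemma is_series_RL_weight_central (m : nat) :
  is_series (fun i => p i * Y i ^ m) (mu m).
Proof.
  apply Series_correct.
  apply ex_series_ext with (2 := ex_series_RL_weight_central m 0). intros i. simpl. ring.
Qed.

(** Coefficient lists run from the lowest degree up; with explicit coefficients, [ring] can check
    each instance of the recurrence. *)
Fixpoint horner (l : list R) (y : R) : R :=
  match l with nil => 0 | cons u l => u + y * horner l y end.

Fixpoint poly_moment (l : list R) (m : nat) : R :=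
  match l with nil => 0 | cons u l => u * mu m + poly_moment l (S m) end.

Lemma is_series_RL_weight_poly (l : list R) (m : nat) :
  is_series (fun i => p i * (Y i ^ m * horner l (Y i))) (poly_moment l m).
Proof.
  revert m. induction l as [|u l IH]; intros m; simpl.
  - apply is_series_ext with (fun i => scal zero (p i * Y i ^ m)).
    { intros i. unfold scal, zero; simpl; unfold mult; simpl. ring. }
    assert (H := is_series_scal_l (V := R_NormedModule) zero _ _ (is_series_RL_weight_central m)).
    exact (eq_ind _ (is_series _) H _ (Rmult_0_l _)).
  - apply is_series_ext with
      (fun i => plus (scal u (p i * Y i ^ m)) (p i * (Y i ^ S m * horner l (Y i)))).
    { intros i. unfold plus, scal; simpl; unfold mult; simpl. ring. }
    apply (is_series_plus (V := R_NormedModule)); [|apply IH].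
    apply (is_series_scal_l (V := R_NormedModule)), is_series_RL_weight_central.
Qed.

(* From [(1 + c) X_{i+1} p_{i+1} = (x + c X_i) p_i], where [X_i = i / b] and [c = a b]:
   summation by shift gives [(1 + c) E (X f(X)) = E ((x + c X) f(X + e))]. *)
Lemma RL_weight_moment_shift (m : nat) (l : list R) :
  (forall y, ((1 + a * b) * x + a * b * y) * (y + e) ^ m = horner l y) ->
  (1 + a * b) * (mu (S m) + x * mu m) = poly_moment l 0.
Proof.
  intros Hl.
  assert (H1 : is_series (fun i => p i * (INR i / b) * Y i ^ m) (mu (S m) + x * mu m)).
  { apply is_series_ext with (fun i => plus (p i * Y i ^ S m) (scal x (p i * Y i ^ m))).
    { intros i. unfold plus, scal; simpl; unfold mult; simpl. ring. }
    apply (is_series_plus (V := R_NormedModule)); [apply is_series_RL_weight_central|].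
    apply (is_series_scal_l (V := R_NormedModule)), is_series_RL_weight_central. }
  (* Shifting the index keeps the sum, since the term at [i = 0] carries the factor
     [INR 0 / b = 0]. *)
  assert (H2 : is_series (fun i => p (S i) * (INR (S i) / b) * Y (S i) ^ m)
                 (mu (S m) + x * mu m)).
  { apply (is_series_incr_1 (V := R_NormedModule) (fun i => p i * (INR i / b) * Y i ^ m)).
    replace (plus _ _) with (mu (S m) + x * mu m); [exact H1|].
    unfold plus; simpl. unfold Rdiv. ring. }
  apply (is_series_scal_l (1 + a * b)) in H2.
  apply is_series_unique in H2.
  etransitivity; [symmetry; exact H2|].
  rewrite <- (is_series_unique _ _ (is_series_RL_weight_poly l 0)).
  apply Series_ext. intros i.
  change (scal ?u ?v) with (u * v). rewrite <- Hl.
  transitivity ((1 + a * b) * (INR (S i) / b) * p (S i) * Y (S i) ^ m); [ring|].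
  rewrite RL_weight_S.
  replace (Y (S i)) with (Y i + e) by (rewrite S_INR; field; lra).
  simpl. field. lra.
Qed.

(** Here [l] lists the coefficients of [((1 + c) * x + c * y) * (y + e) ^ m]. The moment of order
    [m + 1] has coefficient [1 + c] on the left and [c] on the right, so the instance expresses it
    through lower moments. *)
Ltac moment_rec m l :=
  let H := fresh in
  assert (H := RL_weight_moment_shift m l); simpl horner in H; simpl poly_moment in H;
  specialize (H ltac:(intros y; simpl pow; ring)).

Notation c := (a * b).

Lemma RL_weight_moment_0 : mu 0%nat = 1.
Proof.
  unfold RL_moment. rewrite <- Series_RL_weight. apply Series_ext. intros i. simpl. ring.
Qed.

Lemma RL_weight_moment_1 : mu 1%nat = 0.
Proof.
  moment_rec 0%nat (cons ((1+c)*x) (cons c nil)).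
  rewrite RL_weight_moment_0 in H. lra.
Qed.

Lemma RL_weight_moment_2 : mu 2%nat = (1 + c) * x * e.
Proof.
  moment_rec 1%nat (cons ((1+c)*x*e) (cons ((1+c)*x+c*e) (cons c nil))).
  rewrite RL_weight_moment_0, RL_weight_moment_1 in H. lra.
Qed.

Lemma RL_weight_moment_6 : mu 6%nat <= 2400 * (1 + x) ^ 3 * e ^ 3.
Proof.
  assert (Hc : 0 <= c <= 1).
  { split; [apply Rmult_le_pos; lra|]. apply Rcomplements.Rle_div_r; lra. }
  assert (He : 0 < e <= 1).
  { split; [exact inv_b_pos|]. apply Rcomplements.Rle_div_l; lra. }
  assert (M0 := RL_weight_moment_0). assert (M1 := RL_weight_moment_1).
  assert (M2 := RL_weight_moment_2).
  moment_rec 2%nat (cons ((1+c)*x*e^2) (cons ((1+c)*x*(2*e)+c*e^2)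
    (cons ((1+c)*x+c*(2*e)) (cons c nil)))).
  moment_rec 3%nat (cons ((1+c)*x*e^3) (cons ((1+c)*x*(3*e^2)+c*e^3)
    (cons ((1+c)*x*(3*e)+c*(3*e^2)) (cons ((1+c)*x+c*(3*e)) (cons c nil))))).
  moment_rec 4%nat (cons ((1+c)*x*e^4) (cons ((1+c)*x*(4*e^3)+c*e^4)
    (cons ((1+c)*x*(6*e^2)+c*(4*e^3)) (cons ((1+c)*x*(4*e)+c*(6*e^2))
    (cons ((1+c)*x+c*(4*e)) (cons c nil)))))).
  moment_rec 5%nat (cons ((1+c)*x*e^5) (cons ((1+c)*x*(5*e^4)+c*e^5)
    (cons ((1+c)*x*(10*e^3)+c*(5*e^4)) (cons ((1+c)*x*(10*e^2)+c*(10*e^3))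
    (cons ((1+c)*x*(5*e)+c*(10*e^2)) (cons ((1+c)*x+c*(5*e)) (cons c nil))))))).
  rewrite M0, M1 in *.
  set (m2 := mu 2%nat) in *. set (m3 := mu 3%nat) in *. set (m4 := mu 4%nat) in *.
  set (m5 := mu 5%nat) in *. set (m6 := mu 6%nat) in *.
  set (ee := e) in *. set (cc := c) in *. clearbody m2 m3 m4 m5 m6 ee cc.
  assert (E3 : m3 = (1 + cc) * x * ee ^ 2 + 2 * cc * ee * m2) by lra.
  assert (E4 : m4 = (1 + cc) * x * (3 * ee * m2 + ee ^ 3) + cc * (3 * ee * m3 + 3 * ee ^ 2 * m2)) by lra.
  assert (E5 : m5 = (1 + cc) * x * (4 * ee * m3 + 6 * ee ^ 2 * m2 + ee ^ 4)
                    + cc * (4 * ee * m4 + 6 * ee ^ 2 * m3 + 4 * ee ^ 3 * m2)) by lra.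
  assert (E6 : m6 = (1 + cc) * x * (5 * ee * m4 + 10 * ee ^ 2 * m3 + 10 * ee ^ 3 * m2 + ee ^ 5)
                    + cc * (5 * ee * m5 + 10 * ee ^ 2 * m4 + 10 * ee ^ 3 * m3 + 5 * ee ^ 4 * m2)) by lra.
  apply (sixth_moment_bound x ee cc m2 m3 m4 m5 m6); assumption.
Qed.

End Weights.

(** * One-sided calculus on the half line *)

(** [Rmax 0] is 1-Lipschitz with values in the half line, so it extends [f] to a function continuous
    on the whole line. *)
Lemma continuous_Rmax_0_comp (f : R -> R) (x : R) :
  continuous_on half_line f -> continuous (fun t => f (Rmax 0 t)) x.
Proof.
  intros Hf.
  apply (filterlim_comp _ _ _ (Rmax 0) f (locally x)
           (within half_line (locally (Rmax 0 x))) (locally (f (Rmax 0 x)))).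
  - intros P [d Hd]. exists d. intros y Hy. apply Hd; [|apply Rmax_l].
    unfold ball in *; simpl in *; unfold AbsRing_ball, abs, minus, plus, opp in *; simpl in *.
    apply Rle_lt_trans with (2 := Hy).
    unfold Rmax. repeat destruct Rle_dec; unfold Rabs; repeat destruct Rcase_abs; lra.
  - apply Hf, Rmax_l.
Qed.

Lemma D_in_continuous_on (f f' : R -> R) :
  (forall x, 0 <= x -> D_in f f' half_line x) -> continuous_on half_line f.
Proof.
  intros Hf x Hx P [eps HP].
  destruct (cont_deriv f f' half_line x (Hf x Hx) eps (cond_pos eps)) as [d [Hd H]].
  exists (mkposreal d Hd). intros y Hy Hy0. apply HP.
  (* The limit from [cont_deriv] runs over points different from [x], so [y = x] is treated
     apart. *)
  destruct (Req_dec x y) as [<-|Hne]; [apply ball_center|].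
  apply (H y). repeat split; assumption.
Qed.

Lemma D_in_ext (f f' h h' : R -> R) (D : R -> Prop) (x : R) :
  (forall t, f t = h t) -> f' x = h' x -> D_in f f' D x -> D_in h h' D x.
Proof.
  intros Hf Hf' H eps Heps. destruct (H eps Heps) as [d [Hd Hlim]].
  exists d. split; [exact Hd|]. intros t Ht. rewrite <- !Hf, <- Hf'. now apply Hlim.
Qed.

Lemma D_in_is_derive (f f' : R -> R) (x : R) :
  0 < x -> D_in f f' half_line x -> is_derive f x (f' x).
Proof.
  intros Hx Hf. apply is_derive_Reals. intros eps Heps.
  destruct (Hf eps Heps) as [d [Hd H]].
  (* A radius at most [x] keeps [x + h] in the half line. *)
  exists (mkposreal (Rmin d x) (Rmin_pos _ _ Hd Hx)). intros h Hh0 Hh. simpl in Hh.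
  assert (Hhd := Rlt_le_trans _ _ _ Hh (Rmin_l _ _)).
  assert (Hhx := Rlt_le_trans _ _ _ Hh (Rmin_r _ _)).
  specialize (H (x + h)). simpl in H. unfold Rdist in H.
  replace (x + h - x) with h in H by ring. apply H. repeat split; [|lra|exact Hhd].
  unfold half_line. apply Rabs_def2 in Hhx. lra.
Qed.

(* [MVT_gen] asks for two-sided continuity at the end points, which the
   composition with [Rmax 0] provides at [0]. *)
Lemma MVT_half_line (f f' : R -> R) (a b : R) :
  (forall x, 0 <= x -> D_in f f' half_line x) -> 0 <= a -> 0 <= b ->
  exists c, Rmin a b <= c <= Rmax a b /\ f b - f a = f' c * (b - a).
Proof.
  intros Hf Ha Hb.
  assert (Hmin : 0 <= Rmin a b) by now apply Rmin_glb.
  destruct (MVT_gen (fun t => f (Rmax 0 t)) a b f') as [c [Hc Heq]].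
  - intros x Hx. apply is_derive_ext_loc with f.
    + assert (Hx0 : 0 < x) by lra.
      exists (mkposreal x Hx0). intros y Hy.
      unfold ball in Hy; simpl in Hy; unfold AbsRing_ball, abs, minus, plus, opp in Hy; simpl in Hy.
      apply Rabs_def2 in Hy. rewrite Rmax_right by lra. reflexivity.
    + apply D_in_is_derive; [lra|apply Hf; lra].
  - intros x _. apply continuity_pt_filterlim, (continuous_Rmax_0_comp f).
    now apply D_in_continuous_on with f'.
  - exists c. rewrite !Rmax_right in Heq by assumption. now split.
Qed.

(** * The weighted modulus of continuity *)

Lemma weight_plus (x h : R) : weight (x + h) <= 2 * ((1 + h ^ 2) * weight x).
Proof. unfold weight. assert (0 <= (x - h) ^ 2) by apply pow2_ge_0. nra. Qed.

(** The growth bound makes the supremum finite, at most [3 * M] by [weight_plus]; [real] would turn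
    an infinite supremum into 0. *)
Lemma weighted_modulus_bound (g : R -> R) (M d h x : R) :
  (forall t, 0 <= t -> Rabs (g t) <= M * weight t) ->
  0 <= h <= d -> 0 <= x ->
  Rabs (g (x + h) - g x) <= weighted_modulus g d * ((1 + h ^ 2) * (1 + x ^ 2)).
Proof.
  intros HM Hh Hx. unfold weighted_modulus.
  set (E := fun r => _).
  destruct (Lub_Rbar_correct E) as [Hub Hleast].
  set (r := Rabs (g (x + h) - g x) / ((1 + h ^ 2) * (1 + x ^ 2))).
  assert (Hpos : forall u v, 0 < (1 + u ^ 2) * (1 + v ^ 2)).
  { intros u v. assert (Hu := pow2_ge_0 u). assert (Hv := pow2_ge_0 v).
    apply Rmult_lt_0_compat; lra. }
  assert (HM0 : 0 <= M).
  { specialize (HM 0 (Rle_refl 0)). assert (H := Rabs_pos (g 0)). unfold weight in HM. lra. }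
  assert (Hfin : Rbar_le (Lub_Rbar E) (3 * M)).
  { apply Hleast. intros s [h' [x' [Hh' [Hx' ->]]]]. simpl.
    apply Rcomplements.Rle_div_l; [apply Hpos|].
    apply Rle_trans with (1 := Rabs_triang _ _). rewrite Rabs_Ropp.
    assert (H1 := HM (x' + h') ltac:(lra)). assert (H2 := HM x' Hx').
    assert (H3 := Rmult_le_compat_l M _ _ HM0 (weight_plus x' h')).
    unfold weight in *.
    assert (H4 : 0 <= M * (h' ^ 2 * (1 + x' ^ 2))).
    { assert (Hu := pow2_ge_0 h'). assert (Hv := pow2_ge_0 x').
      repeat apply Rmult_le_pos; lra. }
    lra. }
  assert (Hr : Rbar_le r (Lub_Rbar E)).
  { apply Hub. exists h, x. repeat split; try apply Hh; assumption. }
  apply Rcomplements.Rle_div_l; [apply Hpos|].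
  destruct (Lub_Rbar E) as [l| |]; simpl in *; [exact Hr|contradiction|contradiction].
Qed.

Lemma weighted_modulus_pos (g : R -> R) (M d : R) :
  (forall t, 0 <= t -> Rabs (g t) <= M * weight t) -> 0 <= d ->
  0 <= weighted_modulus g d.
Proof.
  intros HM Hd.
  assert (H := weighted_modulus_bound g M d 0 0 HM ltac:(lra) ltac:(lra)).
  rewrite Rplus_0_r, Rminus_eq_0, Rabs_R0 in H. lra.
Qed.

(** The segment from [x] to [y] is cut into equal steps of length at most [d], and the modulus
    bounds each step. The weight increases on the half line, so a bound [W] at the right end serves
    at every step. *)
Lemma weighted_modulus_chain (g : R -> R) (M d : R) :
  (forall t, 0 <= t -> Rabs (g t) <= M * weight t) -> 0 < d <= 1 ->
  forall x y, 0 <= x -> 0 <= y ->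
  Rabs (g y - g x)
  <= 4 * weighted_modulus g d * (1 + Rabs (y - x) / d)
     * ((1 + (y - x) ^ 2) * (1 + x ^ 2)).
Proof.
  intros HM Hd. set (D := weighted_modulus g d).
  assert (HD : 0 <= D) by (apply weighted_modulus_pos with M; [exact HM|lra]).
  assert (Hchain : forall z eta W, 0 <= z -> 0 <= eta <= d -> forall k,
            weight (z + INR k * eta) <= W ->
            Rabs (g (z + INR k * eta) - g z) <= INR k * (2 * D * W)).
  { intros z eta W Hz Heta. induction k as [|k IH]; intros HW.
    - simpl INR. rewrite !Rmult_0_l, Rplus_0_r, Rminus_eq_0, Rabs_R0. lra.
    - set (v := z + INR k * eta) in *.
      assert (Hk : 0 <= INR k * eta) by (apply Rmult_le_pos; [apply pos_INR|lra]).
      replace (z + INR (S k) * eta) with (v + eta) in * by (rewrite S_INR; unfold v; ring).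
      assert (Hw : weight v <= W).
      { apply Rle_trans with (2 := HW). unfold weight.
        assert (v ^ 2 <= (v + eta) ^ 2) by (apply pow_incr; unfold v; lra). lra. }
      specialize (IH Hw).
      assert (Hstep := weighted_modulus_bound g M d eta v HM Heta ltac:(unfold v; lra)).
      fold D in Hstep.
      assert (Heta2 : eta ^ 2 <= 1) by nra.
      (* The factor 2 uses [eta <= d <= 1]. *)
      assert (Hb : (1 + eta ^ 2) * (1 + v ^ 2) <= 2 * W).
      { apply Rmult_le_compat; unfold weight in Hw; try lra.
        - assert (H := pow2_ge_0 eta). lra.
        - assert (H := pow2_ge_0 v). lra. }
      assert (Hb' := Rmult_le_compat_l D _ _ HD Hb).
      replace (g (v + eta) - g z) with ((g (v + eta) - g v) + (g v - g z)) by ring.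
      apply Rle_trans with (1 := Rabs_triang _ _). rewrite S_INR. lra. }
  assert (Hup : forall z h W, 0 <= z -> 0 <= h -> weight (z + h) <= W ->
            Rabs (g (z + h) - g z) <= (1 + h / d) * (2 * D * W)).
  { intros z h W Hz Hh HW.
    assert (Hhd : 0 <= h / d) by (apply Rcomplements.Rdiv_le_0_compat; lra).
    (* With [n <= h / d < n + 1], taking [n + 1] steps makes each at most [d] long and keeps their
       number at most [1 + h / d]. *)
    destruct (nfloor_ex (h / d) Hhd) as [n Hn].
    assert (Hk : 0 < INR (S n)) by (apply lt_0_INR; lia).
    assert (HW0 : 0 <= W).
    { apply Rle_trans with (2 := HW). unfold weight. assert (H := pow2_ge_0 (z + h)). lra. }
    rewrite <- S_INR in Hn.
    assert (Heta : 0 <= h / INR (S n) <= d).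
    { split; [apply Rcomplements.Rdiv_le_0_compat; lra|].
      apply Rcomplements.Rle_div_l; [exact Hk|].
      destruct Hn as [_ Hn]. apply Rcomplements.Rlt_div_l in Hn; lra. }
    assert (Hend : INR (S n) * (h / INR (S n)) = h) by (field; lra).
    assert (H := Hchain z _ W Hz Heta (S n)). rewrite Hend in H.
    apply Rle_trans with (1 := H HW). apply Rmult_le_compat_r.
    - repeat apply Rmult_le_pos; lra.
    - rewrite S_INR. lra. }
  intros x y Hx Hy.
  assert (HW := weight_plus x (y - x)). replace (x + (y - x)) with y in HW by ring.
  destruct (Rle_dec x y) as [Hxy|Hxy].
  - assert (H := Hup x (y - x) (2 * ((1 + (y - x) ^ 2) * weight x)) Hx ltac:(lra)).
    replace (x + (y - x)) with y in H by ring. specialize (H HW).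
    rewrite Rabs_pos_eq with (x := y - x) by lra. unfold weight in H. lra.
  - assert (H := Hup y (x - y) (2 * ((1 + (y - x) ^ 2) * weight x)) Hy ltac:(lra)).
    replace (y + (x - y)) with x in H by ring. rewrite Rabs_minus_sym.
    rewrite Rabs_minus_sym with (x := y), Rabs_pos_eq with (x := x - y) by lra.
    (* When [y < x] the right end is [x]; the same [W] bounds its weight. *)
    assert (Hx2 : weight x <= 2 * ((1 + (y - x) ^ 2) * weight x)).
    { unfold weight. assert (Hu := pow2_ge_0 (y - x)). assert (Hv := pow2_ge_0 x). nra. }
    specialize (H Hx2). unfold weight in H. lra.
Qed.

(** As [d <= 1], [h] is at most [u = h / d], which leaves a cubic in [u], controlled by
    [2 u <= 1 + u^2] and [2 u^2 <= 1 + u^4]. The even power 4 leads to the sixth moment. *)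
Lemma modulus_growth_bound (h d : R) :
  0 <= h -> 0 < d <= 1 -> (1 + h / d) * (1 + h ^ 2) <= 4 * (1 + (h / d) ^ 4).
Proof.
  intros Hh Hd. set (u := h / d).
  assert (Hu : 0 <= u) by (apply Rcomplements.Rdiv_le_0_compat; lra).
  assert (Hhu : h <= u) by (unfold u; apply Rcomplements.Rle_div_r; nra).
  assert (H2 : h ^ 2 <= u ^ 2) by (apply pow_incr; lra).
  apply Rle_trans with ((1 + u) * (1 + u ^ 2)).
  - apply Rmult_le_compat_l; lra.
  - assert (Hu2 := pow2_ge_0 u).
    assert (H3 : 0 <= (u ^ 2 - 1) ^ 2) by apply pow2_ge_0.
    assert (H4 : 2 * u <= 1 + u ^ 2) by (assert (H := pow2_ge_0 (u - 1)); lra).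
    nra.
Qed.

(** * The second-order Taylor remainder *)

Section Taylor.

Context (g g' g'' : R -> R)
  (g_diff : forall x, 0 <= x -> D_in g g' half_line x)
  (g'_diff : forall x, 0 <= x -> D_in g' g'' half_line x).

Definition taylor_rem (x t : R) : R :=
  g t - g x - g' x * (t - x) - g'' x / 2 * (t - x) ^ 2.

Lemma taylor_rem_D_in (x u : R) : 0 <= u ->
  D_in (taylor_rem x) (fun s => g' s - g' x - g'' x * (s - x)) half_line u.
Proof.
  intros Hu. unfold taylor_rem.
  assert (H1 := Dminus _ _ _ _ _ _ (Dx half_line u) (Dconst half_line x u)).
  assert (H2 := Dmult _ _ _ _ _ _ H1 H1).
  assert (H3 := Dminus _ _ _ _ _ _
    (Dminus _ _ _ _ _ _ (Dminus _ _ _ _ _ _ (g_diff u Hu) (Dconst half_line (g x) u))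
       (Dmult_const _ _ _ _ (g' x) H1)) (Dmult_const _ _ _ _ (g'' x / 2) H2)).
  apply D_in_ext with (3 := H3); [intros v; ring|simpl; field].
Qed.

(** The remainder and its derivative vanish at [x]. Two mean values give
    [(g'' s - g'' x) * (c - x) * (t - x)] with [c] between [x] and [t], and [s] between [x] and
    [c]. *)
Lemma taylor_rem_mean_value (x t : R) : 0 <= x -> 0 <= t ->
  exists s, 0 <= s /\ Rabs (s - x) <= Rabs (t - x) /\
    Rabs (taylor_rem x t) <= Rabs (g'' s - g'' x) * (t - x) ^ 2.
Proof.
  intros Hx Ht.
  set (r1 := fun s => g' s - g' x - g'' x * (s - x)).
  assert (D1 : forall u, 0 <= u -> D_in r1 (fun s => g'' s - g'' x) half_line u).
  { intros u Hu. unfold r1.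
    assert (H1 := Dminus _ _ _ _ _ _ (Dx half_line u) (Dconst half_line x u)).
    assert (H3 := Dminus _ _ _ _ _ _
      (Dminus _ _ _ _ _ _ (g'_diff u Hu) (Dconst half_line (g' x) u))
      (Dmult_const _ _ _ _ (g'' x) H1)).
    apply D_in_ext with (3 := H3); [intros v; ring|simpl; ring]. }
  destruct (MVT_half_line _ r1 x t (taylor_rem_D_in x) Hx Ht) as [c [Hc Ec]].
  assert (Hc0 : 0 <= c) by (apply Rle_trans with (2 := proj1 Hc); now apply Rmin_glb).
  destruct (MVT_half_line _ _ x c D1 Hx Hc0) as [s [Hs Es]].
  assert (Hcx : Rabs (c - x) <= Rabs (t - x)).
  { revert Hc. unfold Rmin, Rmax. destruct Rle_dec; intros Hc;
      [rewrite !Rabs_pos_eq|rewrite !Rabs_left1]; lra. }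
  exists s. split; [|split].
  - apply Rle_trans with (2 := proj1 Hs). now apply Rmin_glb.
  - apply Rle_trans with (2 := Hcx).
    revert Hs. unfold Rmin, Rmax. destruct Rle_dec; intros Hs;
      [rewrite !Rabs_pos_eq|rewrite !Rabs_left1]; lra.
  - replace (taylor_rem x t) with ((g'' s - g'' x) * ((c - x) * (t - x))).
    + rewrite Rabs_mult. apply Rmult_le_compat_l; [apply Rabs_pos|].
      rewrite Rabs_mult, <- pow2_abs. simpl. rewrite Rmult_1_r.
      apply Rmult_le_compat_r; [apply Rabs_pos|exact Hcx].
    + rewrite <- Rmult_assoc, <- Es.
      replace (r1 x) with 0 by (unfold r1; ring). rewrite Rminus_0_r, <- Ec.
      unfold taylor_rem. field.
Qed.

Lemma taylor_rem_bound (M d x t : R) :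
  (forall t, 0 <= t -> Rabs (g'' t) <= M * weight t) -> 0 < d <= 1 -> 0 <= x -> 0 <= t ->
  Rabs (taylor_rem x t)
  <= 16 * weighted_modulus g'' d * (1 + x ^ 2) * ((t - x) ^ 2 + (t - x) ^ 6 / d ^ 4).
Proof.
  intros HM Hd Hx Ht.
  destruct (taylor_rem_mean_value x t Hx Ht) as [s [Hs [Hsx Hrem]]].
  apply Rle_trans with (1 := Hrem).
  assert (HD := weighted_modulus_pos g'' M d HM ltac:(lra)).
  assert (Hch := weighted_modulus_chain g'' M d HM Hd x s Hx Hs).
  set (D := weighted_modulus g'' d) in *.
  rewrite <- (pow2_abs (s - x)) in Hch.
  set (h := Rabs (s - x)) in *.
  assert (Hgr := modulus_growth_bound h d (Rabs_pos _) Hd).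
  assert (Hx2 := pow2_ge_0 x).
  assert (Hdx : 0 <= 4 * D * (1 + x ^ 2)) by (repeat apply Rmult_le_pos; lra).
  assert (Hu : (h / d) ^ 4 <= (t - x) ^ 4 / d ^ 4).
  { replace ((t - x) ^ 4) with (Rabs (t - x) ^ 4)
      by (rewrite RPow_abs; apply Rabs_pos_eq; replace 4%nat with (2 * 2)%nat by reflexivity;
          rewrite pow_mult; apply pow2_ge_0).
    unfold Rdiv. rewrite <- pow_inv, <- Rpow_mult_distr. apply pow_incr.
    assert (Hd' : 0 < / d) by (apply Rinv_0_lt_compat; lra).
    split; [apply Rmult_le_pos; [apply Rabs_pos|lra]|].
    apply Rmult_le_compat_r; lra. }
  (* The constant 16 is 4 from the chain of steps times 4 from the growth bound. *)
  replace (16 * D * (1 + x ^ 2) * ((t - x) ^ 2 + (t - x) ^ 6 / d ^ 4))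
    with (4 * D * (1 + x ^ 2) * (4 * (1 + (t - x) ^ 4 / d ^ 4)) * (t - x) ^ 2) by (field; lra).
  apply Rmult_le_compat_r; [apply pow2_ge_0|].
  apply Rle_trans with (1 := Hch).
  replace (4 * D * (1 + h / d) * ((1 + h ^ 2) * (1 + x ^ 2)))
    with (4 * D * (1 + x ^ 2) * ((1 + h / d) * (1 + h ^ 2))) by ring.
  apply Rmult_le_compat_l; [exact Hdx|]. lra.
Qed.

End Taylor.

(** * Continuous functions of at most quadratic growth *)

(** A linear class containing [g], the constants, [t - x] and [(t - x) ^ 2], on which the series of
    the operator converges. *)
Definition admissible (f : R -> R) : Prop :=
  continuous_on half_line f /\ exists M, forall t, 0 <= t -> Rabs (f t) <= M * weight t.

Lemma C_w_k_admissible (f : R -> R) : C_w_k f -> admissible f.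
Proof. intros [Hc [[M [_ HM]] _]]. split; [exact Hc|]. exists M. exact HM. Qed.

Lemma admissible_lin (f h : R -> R) (k : R) :
  admissible f -> admissible h -> admissible (fun t => f t + k * h t).
Proof.
  intros [Hf [M HM]] [Hh [N HN]]. split.
  - intros x Hx.
    apply (filterlim_comp_2 (G := locally (f x)) (H := locally (k * h x))
             f (fun t => k * h t) Rplus); [now apply Hf| |].
    + apply (filterlim_comp _ _ _ h (Rmult k) _ (locally (h x))); [now apply Hh|].
      apply (filterlim_scal_r (V := R_NormedModule) k (h x)).
    + apply (filterlim_plus (V := R_NormedModule)).
  - exists (M + Rabs k * N). intros t Ht.
    apply Rle_trans with (1 := Rabs_triang _ _). rewrite Rabs_mult.
    assert (H := Rmult_le_compat_l (Rabs k) _ _ (Rabs_pos k) (HN t Ht)).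
    specialize (HM t Ht). lra.
Qed.

Lemma continuous_continuous_on_half_line (f : R -> R) :
  (forall t, continuous f t) -> continuous_on half_line f.
Proof.
  intros Hf x _ P HP. destruct (Hf x P HP) as [d Hd].
  exists d. intros y Hy _. now apply Hd.
Qed.

Lemma admissible_const (k : R) : admissible (fun _ => k).
Proof.
  split.
  - apply continuous_continuous_on_half_line. intros t. apply continuous_const.
  - exists (Rabs k). intros t Ht. unfold weight.
    assert (H := Rabs_pos k). assert (H2 := pow2_ge_0 t). nra.
Qed.

Lemma admissible_sub (x : R) : admissible (fun t => t - x).
Proof.
  split.
  - apply continuous_continuous_on_half_line. intros t.
    apply (ex_derive_continuous (fun t => t - x)). auto_derive. trivial.
  - exists (1 + Rabs x). intros t Ht.
    apply Rle_trans with (1 := Rabs_triang _ _). rewrite Rabs_Ropp, (Rabs_pos_eq t Ht).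
    unfold weight. assert (H := Rabs_pos x). assert (H2 := pow2_ge_0 (t - 1)). nra.
Qed.

Lemma admissible_sub_sqr (x : R) : admissible (fun t => (t - x) ^ 2).
Proof.
  split.
  - apply continuous_continuous_on_half_line. intros t.
    apply (ex_derive_continuous (fun t => (t - x) ^ 2)). auto_derive. trivial.
  - exists (2 * (1 + x ^ 2)). intros t Ht.
    rewrite Rabs_pos_eq by apply pow2_ge_0. unfold weight.
    assert (H2 := pow2_ge_0 (t + x)). assert (H3 := pow2_ge_0 (t * x)). nra.
Qed.

(** * The operator as a weighted sum of cell averages *)

Section Operator.

Context (phi psi b a x : R) (Hphi : 0 <= phi <= psi)
  (Hb : 1 <= b) (Ha : 0 <= a <= 1 / b) (Hx : 0 <= x).

Notation p := (RL_weight b a x).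
Notation sigma := (fun t => (b * t + phi) / (b + psi)).

Definition cell (i : nat) (t : R) : Prop := INR i / b <= t <= INR (S i) / b.

(** Cells have length [1 / b], so the factor [b] makes this an average. *)
Definition cell_mean (f : R -> R) (i : nat) : R :=
  b * RInt (fun t => f (sigma t)) (INR i / b) (INR (S i) / b).

Lemma cell_pos (i : nat) (t : R) : cell i t -> 0 <= t.
Proof.
  intros [H _]. apply Rle_trans with (2 := H).
  apply Rcomplements.Rdiv_le_0_compat; [apply pos_INR|lra].
Qed.

Lemma sigma_pos (t : R) : 0 <= t -> 0 <= sigma t.
Proof.
  intros Ht. apply Rcomplements.Rdiv_le_0_compat; [|lra].
  assert (0 <= b * t) by (apply Rmult_le_pos; lra). lra.
Qed.

Lemma cell_length (i : nat) : INR (S i) / b = INR i / b + 1 / b.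
Proof. rewrite S_INR. field. lra. Qed.

Lemma cell_le (i : nat) : INR i / b <= INR (S i) / b.
Proof.
  rewrite cell_length. assert (0 < 1 / b) by (apply Rdiv_lt_0_compat; lra). lra.
Qed.

Lemma ex_RInt_cell (f : R -> R) (i : nat) : continuous_on half_line f ->
  ex_RInt (fun t => f (sigma t)) (INR i / b) (INR (S i) / b).
Proof.
  intros Hf. apply ex_RInt_ext with (fun t => f (Rmax 0 (sigma t))).
  - intros t. rewrite Rmin_left, Rmax_right by apply cell_le. intros Ht.
    rewrite Rmax_right; [reflexivity|]. apply sigma_pos, (cell_pos i). unfold cell. lra.
  - apply (ex_RInt_continuous (V := R_CompleteNormedModule)). intros t _.
    apply (continuous_comp sigma (fun t => f (Rmax 0 t))).
    + apply (ex_derive_continuous sigma). auto_derive. lra.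
    + now apply continuous_Rmax_0_comp.
Qed.

Lemma cell_mean_bound (f : R -> R) (i : nat) (B : R) : continuous_on half_line f ->
  (forall t, cell i t -> Rabs (f (sigma t)) <= B) -> Rabs (cell_mean f i) <= B.
Proof.
  intros Hf HB. unfold cell_mean. rewrite Rabs_mult, (Rabs_pos_eq b) by lra.
  assert (H := abs_RInt_le_const _ _ _ B (cell_le i) (ex_RInt_cell f i Hf) HB).
  apply Rmult_le_compat_l with (r := b) in H; [|lra].
  apply Rle_trans with (1 := H). rewrite cell_length. right. field. lra.
Qed.

Lemma cell_mean_lin (f h : R -> R) (k : R) (i : nat) :
  continuous_on half_line f -> continuous_on half_line h ->
  cell_mean (fun t => f t + k * h t) i = cell_mean f i + k * cell_mean h i.
Proof.
  intros Hf Hh. unfold cell_mean.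
  apply (ex_RInt_cell f i) in Hf. apply (ex_RInt_cell h i) in Hh.
  assert (H := RInt_plus (V := R_CompleteNormedModule) _ _ _ _ Hf
                 (ex_RInt_scal (V := R_NormedModule) _ _ _ k Hh)).
  assert (H' := RInt_scal (V := R_CompleteNormedModule) _ _ _ k Hh).
  etransitivity; [apply f_equal; etransitivity; [exact H|apply f_equal; exact H']|].
  unfold plus, scal; simpl; unfold mult; simpl. ring.
Qed.

Lemma cell_mean_const (k : R) (i : nat) : cell_mean (fun _ => k) i = k.
Proof.
  unfold cell_mean. rewrite RInt_const, cell_length.
  unfold scal; simpl; unfold mult; simpl. field. lra.
Qed.

Lemma ex_series_cell_mean (f : R -> R) : admissible f ->
  ex_series (fun i => p i * cell_mean f i).
Proof.
  (* On cell [i], [b * t <= i + 1] and [b + psi >= 1], so [sigma t <= i + T]; the series is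
     dominated through the moments of order 0, 1 and 2. *)
  intros [Hf [M HM]]. set (T := 1 + phi).
  assert (HM0 : 0 <= M).
  { specialize (HM 0 (Rle_refl 0)). assert (H := Rabs_pos (f 0)). unfold weight in HM. lra. }
  apply (ex_series_le (V := R_CompleteNormedModule)) with
    (fun i => M * ((1 + T ^ 2) * (p i * INR i ^ 0) + 2 * T * (p i * INR i ^ 1)
                   + p i * INR i ^ 2)).
  - intros i. unfold norm; simpl; unfold abs; simpl.
    rewrite Rabs_mult, (Rabs_pos_eq (p i)) by (apply RL_weight_pos; assumption).
    apply Rle_trans with (p i * (M * (1 + (INR i + T) ^ 2))); [|right; ring].
    apply Rmult_le_compat_l; [apply RL_weight_pos; assumption|].
    apply cell_mean_bound; [exact Hf|]. intros t Ht.
    assert (Ht0 := cell_pos i t Ht). assert (Hs := sigma_pos t Ht0).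
    apply Rle_trans with (1 := HM _ Hs). apply Rmult_le_compat_l; [exact HM0|].
    unfold weight. apply Rplus_le_compat_l, pow_incr. split; [exact Hs|].
    assert (Hbt : b * t <= INR (S i)).
    { destruct Ht as [_ Ht]. apply Rcomplements.Rle_div_r in Ht; lra. }
    assert (Hti := pos_INR i).
    apply Rcomplements.Rle_div_l; [lra|]. rewrite S_INR in Hbt. unfold T. nra.
  - apply (ex_series_scal (V := R_NormedModule) M).
    apply (ex_series_plus (V := R_NormedModule));
      [apply (ex_series_plus (V := R_NormedModule))|];
      try apply (ex_series_scal (V := R_NormedModule)); now apply ex_series_RL_weight_pow.
Qed.

Lemma RL_Series (f : R -> R) :
  RL phi psi b a f x = Series (fun i => p i * cell_mean f i).
Proof.
  unfold RL. rewrite <- Series_scal_l. apply Series_ext. intros i.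
  unfold RL_weight, cell_mean. ring.
Qed.

(** Admissibility provides the integrability and the convergence under which the total [RInt] and
    [Series] are additive. *)
Lemma RL_lin (f h : R -> R) (k : R) : admissible f -> admissible h ->
  RL phi psi b a (fun t => f t + k * h t) x = RL phi psi b a f x + k * RL phi psi b a h x.
Proof.
  intros Hf Hh. rewrite !RL_Series, <- Series_scal_l, <- Series_plus.
  - apply Series_ext. intros i.
    rewrite cell_mean_lin by (apply Hf || apply Hh). ring.
  - now apply ex_series_cell_mean.
  - apply (ex_series_scal (V := R_NormedModule)). now apply ex_series_cell_mean.
Qed.

Lemma RL_const (k : R) : RL phi psi b a (fun _ => k) x = k.
Proof.
  rewrite RL_Series. rewrite (Series_ext _ (fun i => k * p i)).
  - rewrite Series_scal_l, Series_RL_weight by assumption. ring.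
  - intros i. rewrite cell_mean_const. ring.
Qed.

(** The weights are nonnegative, so bounds on the cells can be averaged; the dominating series also
    gives absolute convergence. *)
Lemma RL_bound (f : R -> R) (B : nat -> R) (l : R) : continuous_on half_line f ->
  (forall i t, cell i t -> Rabs (f (sigma t)) <= B i) ->
  is_series (fun i => p i * B i) l -> Rabs (RL phi psi b a f x) <= l.
Proof.
  intros Hf HB Hl. rewrite RL_Series, <- (is_series_unique _ _ Hl).
  assert (Hle : forall i, Rabs (p i * cell_mean f i) <= p i * B i).
  { intros i. assert (Hp : 0 <= p i) by (apply RL_weight_pos; assumption).
    rewrite Rabs_mult, (Rabs_pos_eq _ Hp). apply Rmult_le_compat_l; [exact Hp|].
    apply cell_mean_bound; [exact Hf|apply HB]. }
  assert (Hex : ex_series (fun i => p i * B i)) by (exists l; exact Hl).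
  apply Rle_trans with (Series (fun i => Rabs (p i * cell_mean f i))).
  - apply Series_Rabs, (ex_series_le (V := R_CompleteNormedModule)) with (2 := Hex).
    intros i. unfold norm; simpl; unfold abs; simpl. rewrite Rabs_Rabsolu. apply Hle.
  - apply Series_le; [|exact Hex]. intros i. split; [apply Rabs_pos|apply Hle].
Qed.

(** Split [sigma t - x] into [sigma t - t], [t - i / b] and [i / b - x]. The first equals
    [(phi - psi * t) / (b + psi)], the second is at most [1 / b], and
    [t <= x + |i / b - x| + 1 / b]. *)
Lemma sigma_sub_bound (i : nat) (t : R) : cell i t ->
  Rabs (sigma t - x)
  <= (1 + phi + psi * (x + 2)) * (Rabs (INR i / b - x) + 1 / b).
Proof.
  intros Ht. assert (Ht0 := cell_pos i t Ht).
  set (y := INR i / b - x). set (e := 1 / b).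
  assert (He : 0 < e <= 1).
  { split; [apply Rdiv_lt_0_compat; lra|]. apply Rcomplements.Rle_div_l; lra. }
  assert (Hty : Rabs (t - INR i / b) <= e).
  { unfold cell in Ht. rewrite cell_length in Ht. fold e in Ht. rewrite Rabs_pos_eq; lra. }
  assert (Hst : Rabs (sigma t - t) <= e * (phi + psi * t)).
  { replace (sigma t - t) with ((phi - psi * t) / (b + psi)) by (field; lra).
    assert (Hpt : 0 <= psi * t) by (apply Rmult_le_pos; lra).
    unfold Rdiv. rewrite Rabs_mult, Rmult_comm. apply Rmult_le_compat; try apply Rabs_pos.
    - rewrite Rabs_pos_eq by (apply Rlt_le, Rinv_0_lt_compat; lra).
      unfold e, Rdiv. rewrite Rmult_1_l. apply Rinv_le_contravar; lra.
    - apply Rabs_le. lra. }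
  assert (Htx : t <= x + Rabs y + e).
  { assert (H := Rle_abs (t - INR i / b)). assert (H' := Rle_abs y). unfold y in *. lra. }
  assert (H := Rabs_triang (sigma t - t) (t - INR i / b)).
  assert (H' := Rabs_triang ((sigma t - t) + (t - INR i / b)) y).
  assert (Hsum : sigma t - x = sigma t - t + (t - INR i / b) + y) by (unfold y; ring).
  assert (Hy := Rabs_pos y).
  assert (H1 : e * (psi * t) <= e * (psi * (x + 1)) + psi * Rabs y).
  { assert (psi * t <= psi * (x + 1 + Rabs y)) by (apply Rmult_le_compat_l; lra).
    assert (e * (psi * t) <= e * (psi * (x + 1 + Rabs y))) by (apply Rmult_le_compat_l; lra).
    assert (0 <= (1 - e) * (psi * Rabs y)) by (repeat apply Rmult_le_pos; lra).
    lra. }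
  assert (H2 : 0 <= (phi + psi * (x + 1)) * Rabs y).
  { apply Rmult_le_pos; [|lra]. assert (0 <= psi * (x + 1)) by (apply Rmult_le_pos; lra). lra. }
  assert (0 <= psi * e) by (apply Rmult_le_pos; lra).
  cbv beta in *. rewrite Hsum. lra.
Qed.

End Operator.

(** * Power inequalities and the final estimate *)

Lemma pow2_plus_le (u v : R) : (u + v) ^ 2 <= 2 * (u ^ 2 + v ^ 2).
Proof. assert (H := pow2_ge_0 (u - v)). lra. Qed.

(** Cube the quadratic case and use [4 (s^3 + t^3) - (s + t)^3 = 3 (s + t) (s - t)^2] for [s = u^2],
    [t = v^2]. *)
Lemma pow6_plus_le (u v : R) : (u + v) ^ 6 <= 32 * (u ^ 6 + v ^ 6).
Proof.
  assert (Hu := pow2_ge_0 u). assert (Hv := pow2_ge_0 v).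
  replace ((u + v) ^ 6) with (((u + v) ^ 2) ^ 3) by ring.
  apply Rle_trans with ((2 * (u ^ 2 + v ^ 2)) ^ 3).
  - apply pow_incr. split; [apply pow2_ge_0|apply pow2_plus_le].
  - assert (H : 0 <= (u ^ 2 + v ^ 2) * (u ^ 2 - v ^ 2) ^ 2)
      by (apply Rmult_le_pos; [lra|apply pow2_ge_0]).
    lra.
Qed.

Lemma pow_even_le (u v : R) (k : nat) : Rabs u <= v -> u ^ (2 * k) <= v ^ (2 * k).
Proof.
  intros H. rewrite !pow_mult, <- (pow2_abs u). apply pow_incr.
  split; [apply pow2_ge_0|]. apply pow_incr. split; [apply Rabs_pos|exact H].
Qed.

Theorem theorem6p1
  (beta alpha : nat -> R) (phi psi : R)
  (beta_incr : forall n m : nat, (1 <= n)%nat -> (n < m)%nat -> beta n < beta m)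
  (beta_1 : beta 1%nat = 1)
  (beta_lim : is_lim_seq beta p_infty)
  (phi_psi : 0 <= phi <= psi)
  (alpha_bound : forall n : nat, (1 <= n)%nat -> 0 <= alpha n <= 1 / beta n)
  (g g' g'' : R -> R)
  (g_diff : forall x : R, 0 <= x -> D_in g g' half_line x)
  (g'_diff : forall x : R, 0 <= x -> D_in g' g'' half_line x)
  (g_Cw : C_w_k g) (g'_Cw : C_w_k g') (g''_Cw : C_w_k g'') :
  forall x : R, 0 <= x ->
  exists C : R, eventually (fun n : nat =>
    beta n *
      Rabs (RL phi psi (beta n) (alpha n) g x - g x
            - g' x * RL phi psi (beta n) (alpha n) (fun t => t - x) x
            - g'' x / 2 * RL phi psi (beta n) (alpha n) (fun t => (t - x) ^ 2) x)
    <= C * weighted_modulus g'' (sqrt (1 / beta n))).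
Proof.
  intros x Hx.
  destruct g''_Cw as [_ [[M [_ HM]] _]].
  (* [K] is the factor in [sigma_sub_bound]; [K2] and [K6] arise from the second and sixth powers of
     [K * (|Y| + e)]. *)
  set (K := 1 + phi + psi * (x + 2)).
  set (K2 := 2 * K ^ 2). set (K6 := 32 * K ^ 6).
  (* The prefactor comes from the remainder bound; the summands come from
     [mu 2 + e^2 <= (2 x + 1) e] and [mu 6 + e^6 <= (2400 (1 + x)^3 + 1) e^3]. *)
  exists (16 * (1 + x ^ 2) * (K2 * (2 * x + 1) + K6 * (2400 * (1 + x) ^ 3 + 1))).
  exists 1%nat. intros n Hn.
  assert (Hb : 1 <= beta n).
  { destruct (Nat.eq_dec n 1) as [->|Hne]; [lra|].
    rewrite <- beta_1. apply Rlt_le, beta_incr; lia. }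
  specialize (alpha_bound n Hn). clear beta_incr beta_lim.
  set (b := beta n) in *. set (a := alpha n) in *. clearbody a b.
  set (e := 1 / b) in *.
  assert (He : 0 < e <= 1).
  { split; [apply Rdiv_lt_0_compat; lra|]. apply Rcomplements.Rle_div_l; lra. }
  assert (Hbe : b * e = 1) by (unfold e; field; lra).
  set (d := sqrt e).
  assert (Hd : 0 < d <= 1).
  { split; [apply sqrt_lt_R0; lra|]. unfold d. rewrite <- sqrt_1. apply sqrt_le_1; lra. }
  (* This balances the orders: a sixth moment of order [e^3], divided by [d^4], is of order [e]. *)
  assert (Hd2 : d ^ 4 = e ^ 2).
  { replace (d ^ 4) with ((d ^ 2) ^ 2) by ring. unfold d. rewrite pow2_sqrt; lra. }
  assert (HD := weighted_modulus_pos g'' M d HM ltac:(lra)).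
  set (D := weighted_modulus g'' d) in *.
  set (L := fun f => RL phi psi b a f x).
  assert (HL : L (taylor_rem g g' g'' x)
    = L g - g x - g' x * L (fun t => t - x) - g'' x / 2 * L (fun t => (t - x) ^ 2)).
  (* The remainder is built up in the form [f + k * h] required by [RL_lin]; constants are
     reproduced because the total mass is 1. *)
  { set (f1 := fun t => g t + (- g x) * 1).
    set (f2 := fun t => f1 t + (- g' x) * (t - x)).
    assert (A0 : admissible g) by now apply C_w_k_admissible.
    assert (A1 : admissible f1) by (apply admissible_lin; [exact A0|apply admissible_const]).
    assert (A2 : admissible f2) by (apply admissible_lin; [exact A1|apply admissible_sub]).
    transitivity (L (fun t => f2 t + (- (g'' x / 2)) * (t - x) ^ 2)).
    { unfold L, RL. f_equal. apply Series_ext. intros i. f_equal. apply RInt_ext. intros t _.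
      unfold taylor_rem, f2, f1. simpl. ring. }
    unfold L.
    rewrite RL_lin; try assumption; [|apply admissible_sub_sqr].
    unfold f2. rewrite RL_lin; try assumption; [|apply admissible_sub].
    unfold f1. rewrite RL_lin; try assumption; [|apply admissible_const].
    rewrite RL_const by assumption. ring. }
  assert (Hcont : continuous_on half_line (taylor_rem g g' g'' x)).
  { apply D_in_continuous_on with (1 := taylor_rem_D_in g g' g'' g_diff x). }
  fold (L g). fold (L (fun t => t - x)). fold (L (fun t => (t - x) ^ 2)).
  rewrite <- HL.
  set (Q := 16 * D * (1 + x ^ 2)).
  assert (HQ : 0 <= Q).
  { assert (H := pow2_ge_0 x). unfold Q. repeat apply Rmult_le_pos; lra. }
  set (mu := RL_moment b a x).
  assert (HRL : Rabs (L (taylor_rem g g' g'' x))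
    <= Q * (K2 * (mu 2%nat + e ^ 2) + K6 * (mu 6%nat + e ^ 6) / e ^ 2)).
  { apply RL_bound with (B := fun i =>
      Q * (K2 * ((INR i / b - x) ^ 2 + e ^ 2) + K6 * ((INR i / b - x) ^ 6 + e ^ 6) / e ^ 2));
      try assumption.
    - intros i t Ht.
      assert (Ht0 := cell_pos b Hb i t Ht).
      assert (Hs := sigma_pos phi psi b phi_psi Hb t Ht0).
      assert (Hr := taylor_rem_bound g g' g'' g_diff g'_diff M d x _ HM Hd Hx Hs).
      apply Rle_trans with (1 := Hr). fold D. fold Q.
      apply Rmult_le_compat_l; [exact HQ|]. rewrite Hd2.
      assert (Hsb := sigma_sub_bound phi psi b x phi_psi Hb Hx i t Ht).
      fold K in Hsb. fold e in Hsb.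
      assert (P2 := pow_even_le _ _ 1 Hsb). assert (P6 := pow_even_le _ _ 3 Hsb).
      simpl Nat.mul in P2, P6. rewrite Rpow_mult_distr in P2, P6.
      assert (S2 := pow2_plus_le (Rabs (INR i / b - x)) e).
      assert (S6 := pow6_plus_le (Rabs (INR i / b - x)) e).
      rewrite pow2_abs in S2.
      replace (Rabs (INR i / b - x) ^ 6) with ((INR i / b - x) ^ 6) in S6
        by (change 6%nat with (2 * 3)%nat; now rewrite !pow_mult, pow2_abs).
      assert (T2 := Rmult_le_compat_l (K ^ 2) _ _ (pow2_ge_0 K) S2).
      assert (HK6 : 0 <= K ^ 6)
        by (change 6%nat with (2 * 3)%nat; rewrite pow_mult; apply pow_le, pow2_ge_0).
      assert (T6 := Rmult_le_compat_l (K ^ 6) _ _ HK6 S6).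
      assert (Hie : 0 <= / e ^ 2) by (apply Rlt_le, Rinv_0_lt_compat, pow_lt; lra).
      unfold Rdiv. apply Rplus_le_compat; [unfold K2; lra|].
      apply Rmult_le_compat_r; [exact Hie|]. unfold K6. lra.
    (* The dominating bound is a polynomial in [Y] with terms of degree 0, 2 and 6 only, so its mean
       involves just [mu 2] and [mu 6]. *)
    - set (l := (Q * (K2 * e ^ 2 + K6 * e ^ 6 / e ^ 2) :: 0 :: Q * K2 :: 0 :: 0 :: 0
                 :: Q * K6 / e ^ 2 :: nil)%list).
      assert (Hl := is_series_RL_weight_poly b a x Hb alpha_bound Hx l 0).
      replace (poly_moment b a x l 0)
        with (Q * (K2 * (mu 2%nat + e ^ 2) + K6 * (mu 6%nat + e ^ 6) / e ^ 2)) in Hl.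
      + apply is_series_ext with (2 := Hl). intros i. unfold l. simpl horner.
        match goal with |- ?u = ?v => change (u = v :> R) end. field. lra.
      + unfold l. simpl poly_moment. rewrite RL_weight_moment_0 by assumption. fold mu. field. lra. }
  apply Rle_trans with (b * (Q * (K2 * (mu 2%nat + e ^ 2) + K6 * (mu 6%nat + e ^ 6) / e ^ 2))).
  { apply Rmult_le_compat_l; lra. }
  assert (Hmu2 : mu 2%nat <= 2 * x * e).
  { unfold mu. rewrite RL_weight_moment_2 by assumption. fold e.
    assert (Hab : a * b <= 1) by (rewrite <- Hbe, Rmult_comm; apply Rmult_le_compat_l; lra).
    assert (Hxe : 0 <= x * e) by (apply Rmult_le_pos; lra).
    assert (H := Rmult_le_compat_r _ _ _ Hxe Hab). lra. }
  assert (Hmu6 : mu 6%nat <= 2400 * (1 + x) ^ 3 * e ^ 3) by now apply RL_weight_moment_6.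
  assert (He2 : e ^ 2 <= e) by nra.
  assert (He6 : e ^ 6 <= e ^ 3).
  { assert (H := pow_incr (e ^ 2) e 3). assert (0 <= e ^ 2) by apply pow2_ge_0.
    replace ((e ^ 2) ^ 3) with (e ^ 6) in H by ring. apply H. lra. }
  assert (HK2 : 0 <= K2) by (assert (H := pow2_ge_0 K); unfold K2; lra).
  assert (HK6 : 0 <= K6).
  { assert (H := pow2_ge_0 (K ^ 3)). unfold K6. replace (K ^ 6) with ((K ^ 3) ^ 2) by ring. lra. }
  assert (B2 : K2 * (mu 2%nat + e ^ 2) <= K2 * ((2 * x + 1) * e))
    by (apply Rmult_le_compat_l; lra).
  assert (B6 : K6 * (mu 6%nat + e ^ 6) / e ^ 2 <= K6 * (2400 * (1 + x) ^ 3 + 1) * e).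
  { apply Rcomplements.Rle_div_l; [apply pow_lt; lra|].
    replace (K6 * (2400 * (1 + x) ^ 3 + 1) * e * e ^ 2)
      with (K6 * ((2400 * (1 + x) ^ 3 + 1) * e ^ 3)) by ring.
    apply Rmult_le_compat_l; lra. }
  apply Rle_trans with (b * (Q * ((K2 * (2 * x + 1) + K6 * (2400 * (1 + x) ^ 3 + 1)) * e))).
  { apply Rmult_le_compat_l; [lra|]. apply Rmult_le_compat_l; [exact HQ|]. lra. }
  (* The remaining factor [b * e] equals 1. *)
  right. unfold Q.
  match goal with |- b * (?q * (?k * e)) = _ => transitivity (b * e * (q * k)) end; [ring|].
  rewrite Hbe. ring.
Qed.
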